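(* Let $s>2$ and let $\mathcal F$ be a $0$-crossing, $s$-sensitive family of demand functions on $[0,1]$ (under the standing assumptions listed in the context). Then the Cautious Myopic (CM) policy satisfies $$\mathrm{Reg}(\mathrm{CM},\mathcal F)=O(\log n).$$
   Context: **Model.** Prices lie in $[0,1]$; the horizon is $n$ rounds. A demand function is a map $d:[0,1]\to[0,1]$, with revenue function $r(x)=x\,d(x)$. In round $t$ the seller chooses a price $X_t\in[0,1]$ based on $X_1,D_1,\dots,X_{t-1},D_{t-1}$ (a policy), and observes a random demand $D_t$ with mean $d(X_t)$; demands observed at the same price are i.i.d. The random demand $D$ at any price has subgaussian norm $\|D\|_{\rm sg}=\inf\{c>0:\mathbb E[e^{D^2/c^2}]\le 2\}$ at most a constant $c_{\rm sg}$. A policy is a markdown policy if $X_{t-1}\ge X_t$ almost surely for $t=2,\dots,n$. The regret is $\mathrm{Reg}(X,d)=n\max_{p\in[0,1]}p\,d(p)-\mathbb E[\sum_{t=1}^nX_td(X_t)]$, and $\mathrm{Reg}(X,\mathcal F)=\sup_{d\in\mathcal F}\mathrm{Reg}(X,d)$ for a family $\mathcal F$. **Standing assumptions.** Each revenue function $r$ of a member of $\mathcal F$ is differentiable, has a unique maximizer $p^*=p^*(r)$ on $[0,1]$, and $r'(p^* )=0$. **0-crossing family.** $\mathcal F$ is $0$-crossing if: (i) for every $p\in[0,1]$ the map $\Phi_p:\mathcal F\to\mathbb R$, $\Phi_p(d)=d(p)$, is injective; and (ii) there are $\Theta\subseteq\mathbb R$ and a bijection $\theta\mapsto d(\cdot;\theta)$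 from $\Theta$ onto $\mathcal F$ such that $\Theta$ is compact; $d:[0,1]\times\Theta\to\mathbb R$ is twice continuously differentiable; the map $p^*:\Theta\to[0,1]$ sending $\theta$ to the maximizer of $r(x;\theta)=x\,d(x;\theta)$ is $c^*$-Lipschitz for some constant $c^*>0$; and there is a constant $c_2>0$ such that for every $p\in[0,1]$ the inverse $\Phi_p^{-1}$, defined on the range of $\Phi_p$ and taking values in $\Theta$ (identifying $\mathcal F$ with $\Theta$), is $c_2$-Lipschitz. Fix such a parametrization. **$s$-sensitive family** ($s$ an integer). A revenue function $r$ is $s$-sensitive if it is $(s+1)$-times continuously differentiable, $r^{(1)}(p^*(r))=\dots=r^{(s-1)}(p^*(r))=0$ and $r^{(s)}(p^*(r))<0$. The family is $s$-sensitive if its revenue functions satisfy: (a) each is $s$-sensitive; (b) they admit a parametrization $r(p;\theta)$, $\theta\in\Theta$, with $\Theta$ compact, twice continuously differentiable in $(p,\theta)$, and with Lipschitz optimal-price map $p^*:\Theta\to[0,1]$; (c) there is a constant $c_6>0$ with $r^{(s)}(p^*(r))\le -c_6<0$ for every $r$ in the family; (d) for each $0\le j\le s$ there is a constant $c^{(j)}$ with $|r^{(j)}(x;\theta)|\le c^{(j)}$ for all $x\in[0,1]$, $\theta\in\Theta$ (derivatives in $x$). **CM policy.** This is the following markdown policy. The time horizon is partitioned into phases $j=1,\dots,m$, with $m=O(\log n-\log\log n)$, where phase $j$ consists of $t_j=\lceil 9^j\log n\rceil$ rounds. Set $P_1=1$. In phase $j$, select price $P_j$ in all $t_j$ rounds;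 let $\bar D_j$ be the empirical mean of the demands observed in phase $j$, and put $\hat\theta_j=\Phi_{P_j}^{-1}(\bar D_j)$, $w_j=4c_2c_{\rm sg}\sqrt{\log n/t_j}$, $\tilde P_{j+1}=\max\{p^*(\theta):|\theta-\hat\theta_j|\le w_j\}$ (over $\theta\in\Theta$), and $P_{j+1}=\min\{\tilde P_{j+1},P_j\}$.
   Formalization: Since the empirical mean may fall outside the range of Φ_p, where Φ_p^{-1} is undefined, the estimate uses any jointly measurable extension of Φ_p^{-1} to all reals with the same Lipschitz constant c_2; a maximum over an empty set of parameters is read as 0. *)

(* Defs.v *)
From HB Require Import structures.
From mathcomp Require Import all_boot all_order all_algebra.
From mathcomp Require Import all_classical all_reals all_analysis.
Set Implicit Arguments.
Unset Strict Implicit.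
Unset Printing Implicit Defensive.
Import Order.TTheory GRing.Theory Num.Theory.
Import numFieldNormedType.Exports.
Local Open Scope classical_set_scope.
Local Open Scope ring_scope.

(* A function on [0,1] is represented by a function on R whose values outside
   [0,1] are irrelevant; [agree] is equality of functions on [0,1]. *)
Definition I01 (R : realType) : set R := `[0, 1]%classic.
Arguments I01 {R}.

Definition agree (R : realType) (f g : R -> R) : Prop := {in I01, f =1 g}.

(** Differentiability *)

(* Derivatives on [0,1] are taken within [0,1], i.e. one-sided at 0 and 1. *)
Definition dquot (R : realType) (f : R -> R) (x : R) : R -> R :=
  fun y => (f y - f x) / (y - x).

Definition derivable01 (R : realType) (f : R -> R) (x : R) : Prop :=
  cvg (dquot f x @ within I01 x^').

Definition derive01 (R : realType) (f : R -> R) : R -> R :=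
  fun x => lim (dquot f x @ within I01 x^').

Definition derive01n (R : realType) (j : nat) (f : R -> R) : R -> R :=
  iter j (@derive01 R) f.

Definition Ck01 (R : realType) (k : nat) (f : R -> R) : Prop :=
  (forall j x, (j < k)%N -> I01 x -> derivable01 (derive01n j f) x) /\
  {within I01, continuous (derive01n k f)}.

Fixpoint Ck_plane (R : realType) (k : nat) (f : R * R -> R^o) : Prop :=
  continuous f /\
  if k is k'.+1 then
    (forall a, derivable f a (1, 0) /\ derivable f a (0, 1)) /\
    Ck_plane k' (derive f ^~ (1, 0)) /\ Ck_plane k' (derive f ^~ (0, 1))
  else True.

(* [Theta] need not be an interval, so smoothness on the compact set
   [0,1] x Theta means being the restriction of a smooth function on the plane
   (by a cut-off, equivalently on some neighbourhood of [0,1] x Theta). *)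
Definition C2_on (R : realType) (Theta : set R) (f : R -> R -> R) : Prop :=
  exists g : R * R -> R^o, Ck_plane 2 g /\
    forall x theta, I01 x -> Theta theta -> g (x, theta) = f x theta.

(** Demand and revenue functions *)

Definition demand_function (R : realType) (d : R -> R) : Prop :=
  forall x, I01 x -> I01 (d x).

Definition revenue (R : realType) (d : R -> R) : R -> R := fun x => x * d x.

Definition maximizer (R : realType) (r : R -> R) (p : R) : Prop :=
  I01 p /\ forall x, I01 x -> r x <= r p.

Definition opt_price (R : realType) (r : R -> R) : R :=
  xget 0 [set p | maximizer r p].

Definition regular_revenue (R : realType) (r : R -> R) : Prop :=
  [/\ forall x, I01 x -> derivable01 r x,
      exists! p, maximizer r p
    & derive01 r (opt_price r) = 0].

Definition regular_family (R : realType) (F : set (R -> R)) : Prop :=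
  forall d, F d -> demand_function d /\ regular_revenue (revenue d).

(* [theta |-> f ^~ theta] is a bijection from [Theta] onto the family [G] of
   functions on [0,1]. *)
Definition parametrizes (R : realType) (G : set (R -> R)) (Theta : set R)
    (f : R -> R -> R) : Prop :=
  [/\ forall theta, Theta theta -> exists2 g, G g & agree (f ^~ theta) g,
      forall g, G g -> exists2 theta, Theta theta & agree (f ^~ theta) g
    & forall theta theta', Theta theta -> Theta theta' ->
        agree (f ^~ theta) (f ^~ theta') -> theta = theta'].

(* Phi_p^-1 with values in [Theta]; 0 is a dummy value outside its domain, the
   range of [dem p] on [Theta]. *)
Definition inv_demand (R : realType) (Theta : set R) (dem : R -> R -> R)
    (p y : R) : R :=
  xget 0 [set theta | Theta theta /\ dem p theta = y].

Definition zero_crossing (R : realType) (F : set (R -> R)) (Theta : set R)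
    (dem : R -> R -> R) (cstar c2 : R) : Prop :=
  (forall p d d', I01 p -> F d -> F d' -> d p = d' p -> agree d d') /\
  [/\ parametrizes F Theta dem,
      compact Theta,
      C2_on Theta dem,
      0 < cstar /\
        cstar.-lipschitz_Theta
          (fun theta : R^o => opt_price (revenue (dem ^~ theta)) : R^o)
    & 0 < c2 /\ forall p, I01 p ->
        c2.-lipschitz_(dem p @` Theta)
          (fun y : R^o => inv_demand Theta dem p y : R^o)].

Definition sensitive (R : realType) (s : nat) (r : R -> R) : Prop :=
  [/\ Ck01 s.+1 r,
      forall j, (1 <= j < s)%N -> derive01n j r (opt_price r) = 0
    & derive01n s r (opt_price r) < 0].

Definition sensitive_family (R : realType) (s : nat) (F : set (R -> R)) :
    Prop :=
  let Rev : set (R -> R) := [set revenue d | d in F] in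
  [/\ forall r, Rev r -> sensitive s r,
      exists (Theta : set R) (rev : R -> R -> R),
        [/\ parametrizes Rev Theta rev,
            compact Theta,
            C2_on Theta rev,
            exists c : R, c.-lipschitz_Theta
              (fun theta : R^o => opt_price (rev ^~ theta) : R^o)
          & forall j, (j <= s)%N -> exists c : R, forall x theta,
              I01 x -> Theta theta -> `|derive01n j (rev ^~ theta) x| <= c]
    & exists2 c6 : R, 0 < c6 &
        forall r, Rev r -> derive01n s r (opt_price r) <= - c6].

(** Policies, demand observations and regret *)

(* A policy maps the demands observed so far to the next price; past prices
   are themselves determined by the demands.  Rounds are numbered 0, .., n-1. *)
Definition policy (R : realType) := seq R -> R.

Record demand_process (R : realType) := DemandProcess {
  dp_disp : measure_display;
  dp_space : measurableType dp_disp;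
  dp_prob : probability dp_space R;
  dp_demand : nat -> dp_space -> R
}.
Arguments dp_demand {R} S t w : rename.
Arguments dp_prob {R} S : rename.

Definition price (R : realType) (pi : policy R) (S : demand_process R)
    (t : nat) (w : dp_space S) : R :=
  pi (mkseq (dp_demand S ^~ w) t).

Definition sg_norm (R : realType) (mu : set R -> \bar R) : \bar R :=
  ereal_inf [set c%:E | c in [set c : R |
    0 < c /\ (\int[mu]_y (expR (y ^+ 2 / c ^+ 2))%:E <= 2%:E)%E]].

(* [nu p] is the law of the demand at price [p]: conditionally on the past
   demands, the demand of round [t] has law [nu] at the price of round [t]. *)
Definition runs (R : realType) (pi : policy R) (n : nat) (d : R -> R) (csg : R)
    (S : demand_process R) : Prop :=
  (forall t, (t < n)%N -> measurable_fun setT (dp_demand S t)) /\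
  exists nu : R.-pker R ~> R,
    (forall p, I01 p ->
      (\int[nu p]_y y%:E = (d p)%:E)%E /\ (sg_norm (nu p) <= csg%:E)%E) /\
    (forall t (E : set (dp_space S)) (A : set R), (t < n)%N ->
      g_sigma_preimage (fun i : 'I_t => dp_demand S i) E -> measurable A ->
      dp_prob S (E `&` dp_demand S t @^-1` A) =
        (\int[dp_prob S]_(w in E) nu (price pi t w) A)%E).

Definition regret (R : realType) (pi : policy R) (n : nat) (d : R -> R)
    (S : demand_process R) : \bar R :=
  ((n%:R * sup (revenue d @` I01))%:E -
   'E_(dp_prob S)[(fun w => \sum_(t < n) revenue d (price pi t w))%R])%E.

(* [S d] is the demand process when the true demand function is [d]. *)
Definition family_regret (R : realType) (pi : policy R) (n : nat)
    (F : set (R -> R)) (S : (R -> R) -> demand_process R) : \bar R :=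
  ereal_sup [set regret pi n d (S d) | d in F].

(** The Cautious Myopic policy *)

(* The empirical mean of a phase need not lie in the range of Phi_p; [est p] is
   an extension of Phi_p^-1 to all of R with the same Lipschitz constant. *)
Definition inverse_extension (R : realType) (Theta : set R)
    (dem : R -> R -> R) (c2 : R) (est : R -> R -> R) : Prop :=
  measurable_fun (I01 `*` setT) (fun a : R * R => est a.1 a.2) /\
  forall p, I01 p ->
    (forall y, (dem p @` Theta) y -> est p y = inv_demand Theta dem p y) /\
    c2.-lipschitz (est p : R^o -> R^o).

Definition cm_len (R : realType) (n j : nat) : nat :=
  `|Num.ceil (9 ^+ j * ln (n%:R : R))|%N.

(* Total length of phases 1, .., j: phase j occupies the rounds t with
   cm_end n j.-1 <= t < cm_end n j, the last phase being cut at the horizon. *)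
Definition cm_end (R : realType) (n j : nat) : nat :=
  (\sum_(1 <= i < j.+1) cm_len R n i)%N.

Definition cm_completed (R : realType) (n t : nat) : nat :=
  count (fun j => cm_end R n j <= t)%N (iota 1 t).

Definition cm_mean (R : realType) (n : nat) (h : seq R) (j : nat) : R :=
  (\sum_(cm_end R n j.-1 <= t < cm_end R n j) h`_t) / (cm_len R n j)%:R.

Definition cm_width (R : realType) (n : nat) (c2 csg : R) (j : nat) : R :=
  4 * c2 * csg * Num.sqrt (ln n%:R / (cm_len R n j)%:R).

(* A maximum over a compact set; [sup set0 = 0] covers the case where no
   parameter is within [w] of [thetahat]. *)
Definition cm_cautious (R : realType) (Theta : set R) (dem : R -> R -> R)
    (thetahat w : R) : R :=
  sup [set opt_price (revenue (dem ^~ theta)) |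
        theta in [set theta | Theta theta /\ `|theta - thetahat| <= w]].

(* [cm_price .. k] is P_{k+1}. *)
Fixpoint cm_price (R : realType) (Theta : set R) (dem est : R -> R -> R)
    (c2 csg : R) (n : nat) (h : seq R) (k : nat) : R :=
  if k is k'.+1 then
    let P := cm_price Theta dem est c2 csg n h k' in
    Num.min (cm_cautious Theta dem (est P (cm_mean n h k)) (cm_width n c2 csg k))
      P
  else 1.

Definition cm_policy (R : realType) (Theta : set R) (dem est : R -> R -> R)
    (c2 csg : R) (n : nat) : policy R :=
  fun h => cm_price Theta dem est c2 csg n h (cm_completed R n (size h)).

(* Main.v *)
Require Import Defs.
From HB Require Import structures.
From mathcomp Require Import all_boot all_order all_algebra.
From mathcomp Require Import all_classical all_reals all_analysis.
From mathcomp Require Import measurable_realfun.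
From mathcomp Require Import ring lra.
Set Implicit Arguments.
Unset Strict Implicit.
Unset Printing Implicit Defensive.
Import Order.TTheory GRing.Theory Num.Theory.
Import numFieldNormedType.Exports.
Local Open Scope classical_set_scope.
Local Open Scope ring_scope.

(* On the event that in every completed phase the empirical mean demand is
   within [4 csg sqrt (ln n / t_j)] of the true demand, the confidence interval
   around the estimate contains the true parameter, so the price never crosses
   the optimal price [p] from above and, after phase [k], exceeds it by at most
   [O(sqrt (ln n / t_k)) = O(3^-k)].  Sensitivity of order [s >= 3] makes the
   revenue loss of such a price cubic, i.e. [O(27^-k)], while phase [k+1] lasts
   [O(9^k ln n)] rounds: the losses of the phases form a geometric series with
   sum [O(ln n)].  There are at most [ln n] completed phases, and a Chernoff
   bound for the martingale of the demand noises shows that each of them fails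
   with probability at most [2/n], which costs another [O(ln n)]. *)

(** * Moment generating functions *)

Lemma expR_mul_subr_le1 (R : realType) (x : R) : expR x * (1 - x) <= 1.
Proof.
rewrite -[leRHS](divff (lt0r_neq0 (expR_gt0 x))) ler_wpM2l ?expR_ge0//.
by rewrite -expRN expR_ge1Dx.
Qed.

(** By [1 + u <= exp u] it is enough to beat [x + 1 + 2 x^2] when [x <= 1]. For [x <= 0] this
    follows from [exp x <= 1 / (1 - x)], and on [(0, 1]] from the square of the same bound at
    [x / 2]. For [x > 1] already [x <= 2 x^2]. *)
Lemma expR_le_addX (R : realType) (x : R) : expR x <= x + expR (2 * x ^+ 2).
Proof.
have h2 := expR_ge1Dx (2 * x ^+ 2).
have [x0|x0] := leP x 0.
  have h := expR_mul_subr_le1 x.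
  rewrite (le_trans _ (lerD (lexx x) h2))//.
  rewrite -(@ler_pM2r _ (1 - x)); last by lra.
  by rewrite (le_trans h)//; nra.
have [x1|x1] := leP x 1; last first.
  suff : expR x <= expR (2 * x ^+ 2) by lra.
  by rewrite ler_expR; nra.
rewrite (le_trans _ (lerD (lexx x) h2))//.
have h := expR_mul_subr_le1 (x / 2).
have -> : expR x = expR (x / 2) ^+ 2.
  by rewrite expr2 -expRD -splitr.
set e := expR (x / 2) in h *.
have e0 : 0 < e by exact: expR_gt0.
have hh : (e * (1 - x / 2)) ^+ 2 <= 1.
  by apply: exprn_ile1 => //; rewrite mulr_ge0 ?(ltW e0)//; lra.
have u0 : 0 < (1 - x / 2) ^+ 2 by rewrite exprn_gt0//; lra.
rewrite -(@ler_pM2r _ _ u0) -exprMn (le_trans hh)//.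
have -> : (x + (1 + 2 * x ^+ 2)) * (1 - x / 2) ^+ 2 =
  1 + x ^+ 2 * ((1 - x) * (5 / 4 - x / 2)) by field.
by rewrite lerDl mulr_ge0 ?sqr_ge0// mulr_ge0//; lra.
Qed.

Lemma expR_le_mix (R : realType) (p u : R) : 0 <= p <= 1 ->
  expR (p * u) <= (1 - p) + p * expR u.
Proof.
move=> /andP[p0 p1].
(* Convexity, through the tangent line at [p u]. *)
have h1 := expR_ge1Dx (u - p * u).
have h2 := expR_ge1Dx (- (p * u)).
set e := expR (p * u).
have e0 : 0 < e := expR_gt0 _.
have E1 : expR u = e * expR (u - p * u) by rewrite -expRD; congr expR; ring.
have E2 : 1 = e * expR (- (p * u)) by rewrite -expRD subrr expR0.
have g1 : e * (1 + (u - p * u)) <= expR u by rewrite E1 ler_wpM2l// ltW.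
have g2 : e * (1 + (- (p * u))) <= 1 by rewrite [leRHS]E2 ler_wpM2l// ltW.
have q0 : 0 <= 1 - p by lra.
have := lerD (ler_wpM2l q0 g2) (ler_wpM2l p0 g1).
rewrite mulr1; apply: le_trans.
by rewrite le_eqVlt; apply/orP; left; apply/eqP; ring.
Qed.

(* Bounding [exp (l y)] by [l y + exp (2 l^2 y^2)] extracts the mean from a bound
   on the uncentred variable, with a smaller constant than centring first. *)
Lemma mgf_le (R : realType) (mu : {measure set R -> \bar R}) (c m l : R) :
  mu setT = 1%E -> 0 < c ->
  (\int[mu]_y (expR (y ^+ 2 / c ^+ 2))%:E <= 2%:E)%E ->
  (\int[mu]_y y%:E = m%:E)%E -> 2 * l ^+ 2 * c ^+ 2 <= 1 ->
  (\int[mu]_y (expR (l * y))%:E <=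
     (expR (l * m + 2 * l ^+ 2 * c ^+ 2))%:E)%E.
Proof.
move=> mu1 c0 hc hm; set p := (X in X <= 1) => p1.
have p0 : 0 <= p by rewrite /p mulr_ge0 ?sqr_ge0// mulr_ge0 ?sqr_ge0.
have msq : measurable_fun setT (fun y : R => expR (y ^+ 2 / c ^+ 2)).
  by apply: measurableT_comp => //; apply: measurable_funM.
have isq : mu.-integrable setT (EFin \o (fun y : R => expR (y ^+ 2 / c ^+ 2))).
  apply/integrableP; split; first exact/measurable_EFinP.
  rewrite (le_lt_trans _ (ltry 2%R))// (le_trans _ hc)//.
  under eq_integral do rewrite /= ger0_norm ?expR_ge0//.
  by [].
(* The identity is dominated, since [|y| <= c (1 + y^2 / c^2) <= c exp (y^2 / c^2)]. *)
have iid : mu.-integrable setT (EFin \o (fun y : R => y)).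
  apply: (@le_integrable _ _ _ _ _ _ _
    (EFin \o (fun y => c * expR (y ^+ 2 / c ^+ 2)))) => //.
  - exact/measurable_EFinP.
  - move=> y _ /=; rewrite lee_fin.
    rewrite [leRHS]ger0_norm ?mulr_ge0 ?expR_ge0 ?(ltW c0)//.
    rewrite (le_trans _ (ler_wpM2l (ltW c0) (expR_ge1Dx _)))//.
    have -> : c * (1 + y ^+ 2 / c ^+ 2) = (c ^+ 2 + y ^+ 2) / c.
      by field; rewrite gt_eqF.
    rewrite ler_pdivlMr// -(real_normK (num_real y)).
    set a := `|y|; have a0 : 0 <= a by exact: normr_ge0.
    have := sqr_ge0 (a - c); have := sqr_ge0 (a + c); rewrite sqrrB sqrrD.
    clearbody a; move: a0 c0; clear; nra.
  - under [X in integrable _ _ X]eq_fun do rewrite /= EFinM.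
    exact: integrableZl.
(* As [p <= 1], convexity gives [exp (p y^2 / c^2) <= (1 - p) + p exp (y^2 / c^2)]. The right side
   has integral at most [1 + p <= exp p]. *)
apply: (@le_trans _ _ (\int[mu]_y
  ((l * y)%:E + ((1 - p)%:E + (p * expR (y ^+ 2 / c ^+ 2))%:E)))%E).
  apply: ge0_le_integral => //.
  - by apply/measurable_EFinP; apply: measurableT_comp => //; apply: measurable_funM.
  - apply/measurable_EFinP; apply: measurable_funD; first exact: measurable_funM.
    by apply: measurable_funD => //; exact: measurable_funM.
  - move=> y _; rewrite -!EFinD lee_fin.
    rewrite (le_trans (expR_le_addX _))// lerD2l.
    have -> : 2 * (l * y) ^+ 2 = p * (y ^+ 2 / c ^+ 2).
      by rewrite /p; field; rewrite gt_eqF.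
    by rewrite expR_le_mix// p0.
have il : mu.-integrable setT (fun y => (l * y)%:E).
  by under eq_fun do rewrite EFinM; exact: integrableZl.
have ip : mu.-integrable setT (fun y => (p * expR (y ^+ 2 / c ^+ 2))%:E).
  by under eq_fun do rewrite EFinM; exact: integrableZl.
have i1 : mu.-integrable setT (cst (1 - p)%:E).
  apply/integrableP; split; first exact: measurable_cst.
  by rewrite integral_cst// mu1 mule1 /= ltry.
rewrite integralD//; last exact: integrableD.
rewrite integralD//.
under eq_integral do rewrite EFinM.
rewrite integralZl//= hm.
under [X in (_ + (_ + X))%E]eq_integral do rewrite EFinM.
rewrite integralZl//= integral_cst// [X in (_ + (_ * X + _))%E](_ : _ = 1%E) ?mule1;
  last exact: mu1.
apply: (@le_trans _ _ ((l * m)%:E + ((1 - p)%:E + p%:E * 2%:E))%E).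
  by rewrite EFinM leeD2l// leeD2l// lee_wpmul2l.
rewrite -EFinM -!EFinD lee_fin (le_trans _ (expR_ge1Dx _))// -/p.
by rewrite le_eqVlt; apply/orP; left; apply/eqP; ring.
Qed.
(** * Conditioning on the past *)

Section joint_law.
Context d1 d2 d3 (T : measurableType d1) (Y : measurableType d2)
  (Z : measurableType d3) (R : realType).
Variables (P : probability T R) (phi : T -> Y) (D : T -> Z).
Hypotheses (mphi : measurable_fun setT phi) (mD : measurable_fun setT D).
Variable k : R.-pker Y ~> Z.
Hypothesis phiD : forall E A, measurable E -> measurable A ->
  P (phi @^-1` E `&` D @^-1` A) = (\int[P]_(w in phi @^-1` E) k (phi w) A)%E.

Let joint : T -> Y * Z := fun w => (phi w, D w).

Let mjoint : measurable_fun setT joint.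
Proof. exact/measurable_fun_pairP. Qed.

Let image_measure d d' (A : measurableType d) (B : measurableType d')
    (m : {measure set A -> \bar R}) (f : A -> B)
    (mf : measurable_fun setT f) : {measure set B -> \bar R} :=
  measure_function_pushforward__canonical__measure_function_Measure m mf.

Let mu1 : {measure set (Y * Z) -> \bar R} := image_measure P mjoint.

(** The law of [phi] is viewed as a kernel from a point, so that it can be composed with [lift] by
    [kcomp]. *)
Let base : unit -> {measure set Y -> \bar R} := fun=> image_measure P mphi.

Let mbase U : measurable U -> measurable_fun setT (base ^~ U).
Proof. by move=> _; exact: measurable_cst. Qed.

HB.instance Definition _ := isKernel.Build _ _ _ _ _ base mbase.

Let base_uub : measure_fam_uub base.
Proof.
exists 2 => u; rewrite (@le_lt_trans _ _ 1%:E)//; last by rewrite lte_fin ltr1n.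
by rewrite /base /= /pushforward preimage_setT probability_setT.
Qed.

HB.instance Definition _ := Kernel_isFinite.Build _ _ _ _ _ base base_uub.

Let fiber (a : unit * Y) : Z -> Y * Z := pair a.2.

Let mfiber a : measurable_fun setT (fiber a).
Proof.
by apply/measurable_fun_pairP; split;
  [exact: measurable_cst|exact: measurable_id].
Qed.

Let lift : unit * Y -> {measure set (Y * Z) -> \bar R} :=
  fun a => image_measure (k a.2) (mfiber a).

Let mfib U : measurable U -> measurable_fun setT (fun y => k y (pair y @^-1` U)).
Proof.
move=> mU; rewrite (_ : (fun y => _) = (fun y => k y (xsection U y))).
  by apply: measurable_fun_xsection_finite_kernel; rewrite inE.
by apply/funext => y; rewrite xsectionE.
Qed.

Let mlift U : measurable U -> measurable_fun setT (lift ^~ U).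
Proof.
move=> mU.
rewrite (_ : lift ^~ U = (fun y => k y (xsection U y)) \o snd); last first.
  by apply/funext => -[u y]/=; rewrite /pushforward xsectionE.
apply: measurableT_comp => //.
by apply: measurable_fun_xsection_finite_kernel; rewrite inE.
Qed.

HB.instance Definition _ := isKernel.Build _ _ _ _ _ lift mlift.

Let lift_uub : measure_fam_uub lift.
Proof.
exists 2 => a; rewrite (@le_lt_trans _ _ 1%:E)//; last by rewrite lte_fin ltr1n.
by rewrite /lift /= /pushforward preimage_setT prob_kernel.
Qed.

HB.instance Definition _ := Kernel_isFinite.Build _ _ _ _ _ lift lift_uub.

(* The law of [(phi, D)] is the law of [phi] composed with the kernel
   [y |-> dirac y (x) k y], since both measures agree on rectangles. *)
Lemma ge0_integral_joint (f : Y * Z -> \bar R) :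
  measurable_fun setT f -> (forall x, 0 <= f x)%E ->
  (\int[P]_w f (phi w, D w) = \int[P]_w \int[k (phi w)]_z f (phi w, z))%E.
Proof.
move=> mf f0.
have -> : (\int[P]_w f (phi w, D w) = \int[mu1]_x f x)%E.
  by rewrite ge0_integral_pushforward.
have E A : measurable A -> mu1 A = kcomp base lift tt A.
  apply: (measure_unique [set A `*` B | A in measurable & B in measurable]
    (fun=> setT)) => //.
  - by rewrite measurable_prod_measurableType.
  - move=> X1 X2 [A1 mA1 [B1 mB1 <-]] [A2 mA2 [B2 mB2 <-]].
    by rewrite -setXI; exists (A1 `&` A2); [exact: measurableI|];
      exists (B1 `&` B2) => //; exact: measurableI.
  - by move=> _; exists setT => //; exists setT => //; rewrite setXTT.
  - exact: bigcup_const.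
  - move=> _ [A1 mA1 [B1 mB1 <-]].
    have -> : mu1 (A1 `*` B1) = P (phi @^-1` A1 `&` D @^-1` B1) by [].
    rewrite phiD//= /kcomp /base /image_measure /=.
    rewrite ge0_integral_pushforward//; first last.
    - by move=> y _; exact: measure_ge0.
    - by apply: mfib; exact: measurableX.
    rewrite [LHS]integral_mkcond; apply: eq_integral => w _ /=.
    rewrite /pushforward patchE.
    case: ifPn => [/set_mem h|/negP h].
      by congr (k _ _); apply/seteqP; split => [z Bz|z []].
    rewrite (_ : _ @^-1` _ = set0) ?measure0//.
    by apply/seteqP; split => // z [] /= ? _; apply: h; rewrite inE.
  - by move=> _; rewrite /mu1 /= /pushforward preimage_setT probability_setT ltry.
rewrite (@eq_measure_integral _ _ _ _ (kcomp base lift tt)); last first.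
  by move=> A mA _; exact: E.
rewrite integral_kcomp// /base /image_measure ge0_integral_pushforward//; last 2 first.
- rewrite (_ : (fun _ => _) = (fun x => \int[lift x]_z f z)%E \o pair tt)//.
  apply: measurableT_comp; last first.
    by apply/measurable_fun_pairP; split;
      [exact: measurable_cst|exact: measurable_id].
  by apply: measurable_fun_integral_kernel => //; exact: mlift.
- by move=> y _; exact: integral_ge0.
by apply: eq_integral => w _; rewrite /lift /image_measure /= ge0_integral_pushforward.
Qed.

End joint_law.

Section kernel_precomp.
Context d (Y : measurableType d) (R : realType).
Variables (nu : R.-pker R ~> R) (X : Y -> R).

(** The law of the next demand as a kernel from the past, through the price. The proof [mX] is an
    argument so that the kernel structures can be attached to this name. *)
Definition kprecomp (mX : measurable_fun setT X) :
    Y -> {measure set R -> \bar R} := nu \o X.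

Hypothesis mX : measurable_fun setT X.

Let mk U : measurable U -> measurable_fun setT (kprecomp mX ^~ U).
Proof.
by move=> mU; exact: measurableT_comp (measurable_kernel nu _ mU) mX.
Qed.

HB.instance Definition _ := isKernel.Build _ _ _ _ _ (kprecomp mX) mk.

Let mk1 y : kprecomp mX y setT = 1%E.
Proof. exact: prob_kernel. Qed.

HB.instance Definition _ := Kernel_isProbability.Build _ _ _ _ _ (kprecomp mX) mk1.

End kernel_precomp.

Section past.
Context d (T : measurableType d) (R : realType) (D : nat -> T -> R).

(* The carrier of [past t] is [T] itself, with the sigma-algebra generated by
   the observations of the rounds before [t]. *)
Definition past (t : nat) : measurableType _ :=
  g_sigma_algebraType
    (\big[setU/set0]_(i < t) preimage_set_system setT (D i) measurable).

Lemma measurable_past t i : (i < t)%N ->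
  measurable_fun setT (D i : past t -> R).
Proof.
move=> it _ A mA; suff : (\big[setU/set0]_(i < t) preimage_set_system setT (D i) measurable)
    (setT `&` D i @^-1` A) by exact: sub_sigma_algebra.
by rewrite (bigD1 (Ordinal it))//=; left; exists A.
Qed.

Lemma past_sub t n (E : set T) : (t <= n)%N ->
  measurable (E : set (past t)) -> measurable (E : set (past n)).
Proof.
move=> tn; apply: smallest_sub; first exact: smallest_sigma_algebra.
apply: subset_trans (@sub_sigma_algebra _ setT _).
apply: (big_ind (subset^~ _)) => // [A B sA sB|i _]; first by rewrite subUset.
rewrite (bigD1 (widen_ord tn i))//=; exact: subsetUl.
Qed.

Lemma measurable_past_widen t n d' (U : measurableType d') (f : T -> U) :
  (t <= n)%N -> measurable_fun setT (f : past t -> U) ->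
  measurable_fun setT (f : past n -> U).
Proof. by move=> tn mf _ A mA; apply: past_sub tn _; exact: mf. Qed.

Lemma past_measurable n (E : set T) :
  (forall t, (t < n)%N -> measurable_fun setT (D t)) ->
  measurable (E : set (past n)) -> measurable E.
Proof.
move=> mD; apply: smallest_sub; first exact: sigma_algebra_measurable.
apply: (big_ind (subset^~ _)) => // [A B sA sB|i _]; first by rewrite subUset.
by move=> _ [A mA <-]; exact: mD.
Qed.

Lemma measurable_past_fun n d' (U : measurableType d') (f : T -> U) :
  (forall t, (t < n)%N -> measurable_fun setT (D t)) ->
  measurable_fun setT (f : past n -> U) -> measurable_fun setT f.
Proof. by move=> mD mf _ A mA; apply: past_measurable mD _; exact: mf. Qed.

End past.

(** * Chernoff bound for the demand noises *)

Section concentration.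
Context d (T : measurableType d) (R : realType) (P : probability T R).
Variables (n : nat) (D X : nat -> T -> R) (nu : R.-pker R ~> R).
Variables (dem : R -> R) (c : R).
Hypothesis mD : forall t, (t < n)%N -> measurable_fun setT (D t).
Hypothesis mX : forall t, (t < n)%N ->
  measurable_fun setT (X t : past D t -> R).
Hypothesis X01 : forall t w, (t < n)%N -> I01 (X t w).
Hypothesis law : forall t E A, (t < n)%N ->
  measurable (E : set (past D t)) -> measurable A ->
  P (E `&` D t @^-1` A) = (\int[P]_(w in E) nu (X t w) A)%E.
Hypothesis mdem : measurable_fun (I01 : set R) dem.
Hypothesis c0 : 0 < c.
Hypothesis nu_mean : forall p, I01 p -> (\int[nu p]_y y%:E = (dem p)%:E)%E.
Hypothesis nu_sg : forall p, I01 p ->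
  (\int[nu p]_y (expR (y ^+ 2 / c ^+ 2))%:E <= 2%:E)%E.

Definition noise (a b : nat) (w : T) : R :=
  \sum_(a <= t < b) (D t w - dem (X t w)).

Lemma measurable_demX t : (t < n)%N ->
  measurable_fun setT (dem \o X t : past D t -> R).
Proof.
move=> tn; apply: (measurable_comp (F := I01)) => //.
- exact: measurable_itv.
- by move=> _ [w _ <-]; exact: X01.
- exact: mX.
Qed.

Lemma measurable_noise a b : (a <= b)%N -> (b <= n)%N ->
  measurable_fun setT (noise a b : past D b -> R).
Proof.
move=> ab; rewrite -(subnKC ab); elim: (b - a)%N => [|k IH] bn.
  rewrite (_ : noise a (a + 0) = cst 0); first exact: measurable_cst.
  by apply/funext => w; rewrite /noise addn0 big_geq.
rewrite addnS.
rewrite (_ : noise a (a + k).+1 = fun w =>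
    noise a (a + k) w + (D (a + k) w - dem (X (a + k) w))); last first.
  by apply/funext => w; rewrite /noise big_nat_recr ?leq_addr.
have kn : (a + k < n)%N by rewrite -addnS.
apply: measurable_funD.
  exact: (@measurable_past_widen _ _ _ D _ _ _ _ _ (leqnSn (a + k))
    (IH (ltnW kn))).
apply: measurable_funB; first exact: (@measurable_past _ _ _ D _ _ (ltnSn (a + k))).
exact: (@measurable_past_widen _ _ _ D _ _ _ _ _ (leqnSn (a + k))
  (measurable_demX kn)).
Qed.

(** Induction on the number of rounds. The last price depends on earlier demands only, so
    integrating out the last demand first, with [ge0_integral_joint] and [mgf_le], costs a factor at
    most [exp p]. *)
Lemma noise_mgf l a b : (a <= b)%N -> (b <= n)%N ->
  2 * l ^+ 2 * c ^+ 2 <= 1 ->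
  (\int[P]_w (expR (l * noise a b w))%:E <=
   (expR ((b - a)%:R * (2 * l ^+ 2 * c ^+ 2)))%:E)%E.
Proof.
set p := 2 * l ^+ 2 * c ^+ 2 => ab + p1; rewrite -{1 2}(subnKC ab).
elim: (b - a)%N => [|k IH] bn.
  under eq_integral do rewrite /noise addn0 big_geq// mulr0 expR0.
  by rewrite mul0r expR0 integral_cst// mul1e; exact: probability_le1.
have kn : (a + k < n)%N by rewrite -addnS.
have mDlt t : (t < a + k)%N -> measurable_fun setT (D t).
  by move=> tk; apply: mD; exact: ltn_trans kn.
(* The identity into the coarser sigma-algebra of the past serves as the conditioning map [phi]. *)
have mid : measurable_fun setT (id : T -> past D (a + k)).
  by move=> _ A mA; rewrite setTI; exact: past_measurable mDlt mA.
(* [h] collects the part of the exponential that is known before round [a + k]. *)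
pose h (w : past D (a + k)) :=
  expR (l * noise a (a + k) w - l * dem (X (a + k) w)).
have mh : measurable_fun setT h.
  apply: measurableT_comp => //; apply: measurable_funB.
    apply: measurable_funM => //; apply: measurable_noise; rewrite ?leq_addr//.
    exact: ltnW.
  by apply: measurable_funM => //; exact: measurable_demX.
pose f (x : past D (a + k) * R) := (h x.1 * expR (l * x.2))%:E.
have -> : (\int[P]_w (expR (l * noise a (a + k.+1) w))%:E =
    \int[P]_w f (w, D (a + k) w))%E.
  apply: eq_integral => w _; rewrite /f /h /= -expRD; congr (expR _)%:E.
  by rewrite /noise addnS big_nat_recr ?leq_addr//=; ring.
rewrite (@ge0_integral_joint _ _ _ T (past D (a + k)) _ R P id (D (a + k)) mid
  (mD kn) (kprecomp nu (mX kn)))//; last 3 first.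
- by move=> E A mE mA; exact: law.
- apply/measurable_EFinP; apply: measurable_funM; first exact: measurableT_comp.
  by apply: measurableT_comp => //; apply: measurable_funM.
- by move=> x; rewrite lee_fin mulr_ge0 ?expR_ge0.
have step w : (\int[nu (X (a + k) w)]_z f (w, z) <=
    (expR (l * noise a (a + k) w) * expR p)%:E)%E.
  rewrite /f /=; under eq_integral do rewrite EFinM.
  rewrite ge0_integralZl_EFin ?expR_ge0//; last first.
    by apply/measurable_EFinP; apply: measurableT_comp => //; exact: measurable_funM.
  have X1 := X01 w kn.
  apply: (@le_trans _ _ ((h w)%:E * (expR (l * dem (X (a + k) w) + p))%:E)%E).
    rewrite lee_wpmul2l ?lee_fin ?expR_ge0//.
    by apply: mgf_le => //; [exact: prob_kernel|exact: nu_sg|exact: nu_mean].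
  rewrite -EFinM lee_fin -!expRD ler_expR le_eqVlt; apply/orP; left.
  by apply/eqP; ring.
have mN : measurable_fun setT (noise a (a + k)).
  by apply: (measurable_past_fun mDlt); apply: measurable_noise; rewrite ?leq_addr// ltnW.
have me : measurable_fun setT (fun w => (expR (l * noise a (a + k) w))%:E).
  by apply/measurable_EFinP; apply: measurableT_comp => //; exact: measurable_funM.
apply: (@le_trans _ _
  (\int[P]_w ((expR p)%:E * (expR (l * noise a (a + k) w))%:E))%E).
  apply: ge0_le_integral => //.
  - by move=> w _; apply: integral_ge0 => z _; rewrite lee_fin mulr_ge0 ?expR_ge0.
  - have mk : measurable_fun setT (kfcomp (kprecomp nu (mX kn)) f).
      apply: measurable_kfcomp; last by move=> x; rewrite lee_fin mulr_ge0 ?expR_ge0.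
      apply/measurable_EFinP; apply: measurable_funM; first exact: measurableT_comp.
      by apply: measurableT_comp => //; apply: measurable_funM.
    exact: (measurable_past_fun mDlt mk).
  - exact: measurable_funeM.
  - by move=> w _; rewrite -EFinM mulrC; exact: step.
rewrite ge0_integralZl_EFin ?expR_ge0//.
apply: (@le_trans _ _ ((expR p)%:E * (expR ((a + k - a)%:R * p))%:E)%E).
  by rewrite lee_wpmul2l ?lee_fin ?expR_ge0//; rewrite addKn; apply: IH; exact: ltnW.
by rewrite -EFinM lee_fin -expRD ler_expR addKn -[k.+1%:R]natr1 mulrDl mul1r
  addrC lexx.
Qed.

(** Chernoff's inequality for the noise and for its opposite, followed by a union bound; the sign is
    the [e] with [e ^+ 2 = 1] below. *)
Lemma noise_tail l u a b : (a <= b)%N -> (b <= n)%N ->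
  0 < l -> 2 * l ^+ 2 * c ^+ 2 <= 1 ->
  (P [set w | u <= `|noise a b w|]%R <=
   (2 * expR ((b - a)%:R * (2 * l ^+ 2 * c ^+ 2) - l * u))%:E)%E.
Proof.
move=> ab bn l0 p1.
have mN : measurable_fun setT (noise a b).
  apply: (@measurable_past_fun _ _ _ D b _ _ _ _ (measurable_noise ab bn)) => t tb.
  by apply: mD; exact: leq_trans tb bn.
have half (e : R) : e ^+ 2 = 1 -> (P [set w | u <= e * noise a b w]%R <=
    (expR ((b - a)%:R * (2 * l ^+ 2 * c ^+ 2) - l * u))%:E)%E.
  move=> e1.
  have mY : measurable_fun setT (fun w => e * noise a b w).
    exact: measurable_funM.
  pose Y : {RV P >-> R} := HB.pack (fun w => e * noise a b w)
    (isMeasurableFun.Build _ _ _ _ _ mY).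
  apply: (le_trans (chernoff Y u l0)).
  rewrite expRD EFinM lee_wpmul2r ?lee_fin ?expR_ge0//.
  rewrite /mmt_gen_fun unlock.
  have := @noise_mgf (l * e) a b ab bn.
  rewrite exprMn e1 mulr1 => /(_ p1); apply: le_trans.
  rewrite le_eqVlt; apply/orP; left; apply/eqP; apply: eq_integral => w _ /=.
  by congr (expR _)%:E; ring.
have mS (e : R) : measurable [set w | u <= e * noise a b w].
  rewrite -[X in measurable X]setTI.
  by apply: measurable_fun_le => //; exact: measurable_funM.
rewrite [X in P X](_ : _ = [set w | u <= 1 * noise a b w] `|`
    [set w | u <= -1 * noise a b w]); last first.
  apply/seteqP; split => w /=; rewrite mul1r mulN1r ler_normr.
    by move=> /orP.
  by move=> h; apply/orP.
apply: (le_trans (measureU2 _ (mS _) (mS _))).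
by rewrite mulrDl mul1r EFinD leeD// half// ?sqrrN expr1n.
Qed.
End concentration.

(** * Taylor estimate *)

Section derive01.
Variable R : realType.
Implicit Types (f g r : R -> R) (x y p c : R).

Lemma agree_dquot f g x : agree f g -> I01 x ->
  dquot f x @ within I01 x^' = dquot g x @ within I01 x^'.
Proof.
move=> fg x1.
have H (f' g' : R -> R) : agree f' g' -> forall A : set R,
    (dquot f' x @ within I01 x^') A -> (dquot g' x @ within I01 x^') A.
  move=> fg' A; rewrite /= !nbhs_filterE /fmap /= /within /=.
  apply: filterS => y /= h y1; move: (h y1).
  by rewrite /dquot !fg'// inE.
by apply/seteqP; split => A; apply: H => // y hy; rewrite fg.
Qed.

Lemma agree_derive01n j f g : agree f g -> agree (derive01n j f) (derive01n j g).
Proof.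
move=> fg; elim: j => //= j IH x /set_mem x1.
by rewrite /derive01 (agree_dquot IH).
Qed.

Lemma derivable01_dist f x e : derivable01 f x -> 0 < e ->
  exists2 d, 0 < d & forall y, I01 y -> y != x -> `|y - x| < d ->
    `|derive01 f x - dquot f x y| < e.
Proof.
move=> /cvgrPdist_lt/(_ e) h /h; rewrite /dnbhs /within /=.
move=> /nbhs_ballP[d /= d0 hd]; exists d => // y y1 yx xy.
by apply: hd => //; rewrite /ball /= distrC.
Qed.

(** At an interior point a whole neighbourhood lies in [0,1], so the derivative within [0,1] is the
    usual one and the mean value theorem becomes available. *)
Lemma derivable01_is_derive f x : derivable01 f x -> 0 < x < 1 ->
  is_derive x 1 f (derive01 f x).
Proof.
move=> df /andP[x0 x1].
have H : (fun h : R => h^-1 *: ((f \o shift x) (h *: 1) - f x)) @ 0^' -->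
    derive01 f x.
  apply/cvgrPdist_lt => e e0.
  have [d d0 hd] := derivable01_dist df e0.
  have m0 : 0 < Num.min d (Num.min x (1 - x)) by rewrite !lt_min d0 x0 subr_gt0.
  rewrite /dnbhs /within /=; apply/nbhs_ballP.
  exists (Num.min d (Num.min x (1 - x))) => //= h.
  rewrite /ball /= sub0r normrN !lt_min => /and3P[hd1 hx hx1] h0.
  rewrite [h *: 1]mulr1.
  have := hd (h + x); rewrite /dquot addrK mulrC; apply => //.
  - rewrite /I01 /= in_itv /=.
    by move: hx hx1; rewrite !ltr_norml => /andP[? ?] /andP[? ?]; apply/andP; split; lra.
  - by rewrite -subr_eq0 addrK.
apply: DeriveDef; first exact: cvgP H.
by rewrite /derive; apply/cvg_lim => //; exact: norm_hausdorff.
Qed.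

Lemma derivable01_continuous f x : derivable01 f x ->
  f @ within I01 (nbhs x) --> f x.
Proof.
move=> df; apply/cvgrPdist_lt => e e0.
have [d d0 hd] := derivable01_dist df (ltr01 : 0 < 1 :> R).
set L := derive01 f x in hd.
have L0 : 0 < `|L| + 1 by rewrite ltr_wpDl.
have m0 : 0 < Num.min d (e / (`|L| + 1)) by rewrite lt_min d0 divr_gt0.
rewrite /within /=; apply/nbhs_ballP; exists (Num.min d (e / (`|L| + 1))) => //= y.
rewrite /ball /= lt_min distrC => /andP[yd ye] y1.
have [->|yx] := eqVneq y x; first by rewrite subrr normr0.
have hq : `|dquot f x y| < `|L| + 1.
  have := hd _ y1 yx yd; rewrite distrC => h.
  rewrite -(subrK L (dquot f x y)) (le_lt_trans (ler_normD _ _))// addrC.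
  by rewrite ltrD2l.
have -> : f x - f y = - (dquot f x y * (y - x)).
  by rewrite /dquot divfK ?subr_eq0// opprB.
rewrite normrN normrM.
rewrite (@lt_trans _ _ ((`|L| + 1) * `|y - x|))//.
  by rewrite ltr_pM2r// normr_gt0 subr_eq0.
by rewrite mulrC -ltr_pdivlMr.
Qed.

Lemma derive01_mean_value f p y c : I01 p -> I01 y -> p <= y ->
  (forall x, I01 x -> derivable01 f x) ->
  (forall x, p <= x <= y -> `|derive01 f x| <= c) ->
  `|f y - f p| <= c * (y - p).
Proof.
rewrite /I01 /= !in_itv /= => /andP[p0 p1] /andP[y0 y1] py df hc.
have I1 x : p <= x <= y -> I01 x.
  by rewrite /I01 /= in_itv /= => /andP[? ?]; apply/andP; split; lra.
have hd x : x \in `]p, y[%R -> is_derive x 1 f (derive01 f x).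
  rewrite in_itv /= => /andP[px xy]; apply: derivable01_is_derive.
    by apply: df; apply: I1; rewrite !ltW.
  by apply/andP; split; lra.
have cf : {within `[p, y], continuous f}.
  apply/subspace_continuousP => x; rewrite /= in_itv /= => xpy.
  apply: cvg_trans (derivable01_continuous (df _ (I1 _ xpy))).
  apply: cvg_app => A; rewrite /within /= => hA.
  by apply: (@filterS _ (nbhs x)) hA => z hz; rewrite in_itv /= => /I1/hz.
have [z zpy ->] := MVT_segment py hd cf.
rewrite normrM (ger0_norm (x := y - p)) ?subr_ge0// ler_wpM2r ?subr_ge0//.
by apply: hc; move: zpy; rewrite in_itv.
Qed.

(** The mean value bound is applied three times, to [r''], [r'] and [r], each application gaining a
    factor [y - p]. The factor 1/6 is given up. *)
Lemma taylor3 r p y c : I01 p -> I01 y -> p <= y ->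
  (forall j x, (j < 3)%N -> I01 x -> derivable01 (derive01n j r) x) ->
  derive01n 1 r p = 0 -> derive01n 2 r p = 0 ->
  (forall x, I01 x -> `|derive01n 3 r x| <= c) ->
  `|r y - r p| <= c * (y - p) ^+ 3.
Proof.
move=> p1 y1 py dr r1 r2 r3.
have c0 : 0 <= c by exact: le_trans (normr_ge0 _) (r3 _ p1).
have sub x : p <= x <= y -> I01 x.
  move: p1 y1; rewrite /I01 /= !in_itv /= => /andP[? ?] /andP[? ?] /andP[? ?].
  by apply/andP; split; lra.
have h2 x : p <= x <= y -> `|derive01n 2 r x| <= c * (y - p).
  move=> xpy; have /andP[px xy] := xpy.
  have := @derive01_mean_value (derive01n 2 r) p x c p1 (sub _ xpy) px.
  rewrite r2 subr0 => h; apply: le_trans (h _ _) _.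
  - by move=> z z1; exact: dr.
  - by move=> z /andP[pz zx]; apply/r3/sub; rewrite pz (le_trans zx).
  - by rewrite ler_wpM2l// lerD2r.
have h1 x : p <= x <= y -> `|derive01n 1 r x| <= c * (y - p) ^+ 2.
  move=> xpy; have /andP[px xy] := xpy.
  have := @derive01_mean_value (derive01n 1 r) p x (c * (y - p)) p1 (sub _ xpy) px.
  rewrite r1 subr0 => h; apply: le_trans (h _ _) _.
  - by move=> z z1; exact: dr.
  - by move=> z /andP[pz zx]; apply/h2; rewrite pz (le_trans zx).
  - by rewrite expr2 mulrA ler_wpM2l ?lerD2r// mulr_ge0 ?subr_ge0.
have := @derive01_mean_value r p y (c * (y - p) ^+ 2) p1 y1 py.
rewrite -mulrA -exprSr; apply => //.
by move=> z z1; exact: (dr 0%N).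
Qed.

End derive01.

(** * The price path *)

(* Compactness of [K] makes each set where the supremum is reached at height at
   least [c] closed. *)
Lemma measurable_window_sup (R : realType) (K : set R) (q : R -> R) (L w : R) :
  compact K -> (forall a b, K a -> K b -> `|q a - q b| <= L * `|a - b|) ->
  (forall a, K a -> 0 <= q a <= 1) ->
  measurable_fun setT
    (fun t : R => sup [set q a | a in [set a | K a /\ `|a - t| <= w]]).
Proof.
move=> cK Lq q01.
have Ub t : has_ubound [set q a | a in [set a | K a /\ `|a - t| <= w]].
  by exists 1 => _ [a [Ka _] <-]; case/andP: (q01 _ Ka).
have cl c : closed [set t | exists a, [/\ K a, c <= q a & `|a - t| <= w]].
  (* [q] is controlled on [K] only, so closedness is checked by hand: a limit point with [q a < c]
     would have neighbours in [K] where [q] is still below [c]. *)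
  have cKc : compact (K `&` [set a | c <= q a]).
    apply: (subclosed_compact _ cK); last by move=> a [].
    move=> a ha.
    have Ka : K a.
      have := compact_closed (@norm_hausdorff _ _) cK; apply.
      by move=> B /ha[b [[Kb _] Bb]]; exists b.
    split => //; rewrite /= leNgt; apply/negP => qac.
    have L1 : 0 < `|L| + 1 by rewrite ltr_wpDl.
    have e0 : 0 < (c - q a) / (`|L| + 1) by rewrite divr_gt0// subr_gt0.
    have [b [[Kb /= qb]]] := ha _ (nbhsx_ballx a _ e0).
    rewrite /ball /= ltr_pdivlMr// => ab.
    have := Lq b a Kb Ka; rewrite distrC => h.
    have := ler_norm L; have := normr_ge0 (a - b); have := normr_ge0 L.
    have := ler_norm (q b - q a); rewrite distrC.
    by rewrite (distrC b a) in h; nra.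
  (* The set is the Minkowski sum of a compact set and [[-w, w]], hence compact. *)
  rewrite (_ : mkset _ = (fun x : R * R => x.1 + x.2) @`
      ((K `&` [set a | c <= q a]) `*` `[- w, w]%classic)).
    apply: compact_closed; first exact: norm_hausdorff.
    apply: continuous_compact.
      by apply: continuous_subspaceT => x; apply: cvgD; [exact: cvg_fst|exact: cvg_snd].
    by apply: compact_setX => //; exact: segment_compact.
  apply/seteqP; split => t /=.
    move=> [a [Ka qa aw]]; exists (a, t - a); last by rewrite /= addrC subrK.
    by split => //=; rewrite in_itv /= -ler_norml distrC.
  move=> [[a v] /= [[Ka qa]]]; rewrite in_itv /= -ler_norml => vw <-.
  by exists a; split => //; rewrite opprD addrA subrr sub0r normrN.
move=> _; apply: (measurability _ (RGenOInfty.measurableE R)) => //.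
move=> _ [_ [y ->] <-]; rewrite setTI.
(* The supremum is never negative, even over an empty window, where it is 0. *)
have [y0|y0] := ltP y 0.
  rewrite (_ : _ @^-1` _ = setT)//; apply/seteqP; split => // t _ /=.
  rewrite in_itv /= andbT (lt_le_trans y0)//.
  have [[_ [a ha _]]|/nonemptyPn S0] :=
    pselect ([set q a | a in [set a | K a /\ `|a - t| <= w]] !=set0);
    last by rewrite S0 sup0.
  case: (ha) => Ka _; have /andP[qa _] := q01 _ Ka.
  by rewrite (le_trans qa)//; apply: ub_le_sup => //; exists a.
(* The supremum exceeds [y] iff some value reaches [y + 1/(k+1)] for some [k]: a countable union of
   closed sets. *)
rewrite (_ : _ @^-1` _ = \bigcup_k
    [set t | exists a, [/\ K a, y + k.+1%:R^-1 <= q a & `|a - t| <= w]]).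
  by apply: bigcup_measurable => k _; exact: closed_measurable.
apply/seteqP; split => t /=; rewrite in_itv /= andbT.
  have [S0|/nonemptyPn S0] :=
    pselect ([set q a | a in [set a | K a /\ `|a - t| <= w]] !=set0);
    last by rewrite S0 sup0 ltNge y0.
  move=> /(sup_gt S0)[_ [a [Ka aw] <-] yq].
  have [k hk] := ltr_add_invr yq.
  by exists k => //=; exists a; split => //; exact: ltW.
move=> [k _ /= [a [Ka hq aw]]].
apply: (@lt_le_trans _ _ (q a)); last by apply: ub_le_sup => //; exists a.
by rewrite (lt_le_trans _ hq)// ltrDl.
Qed.

Lemma opt_priceP (R : realType) (r : R -> R) :
  (exists! p, maximizer r p) -> maximizer r (opt_price r).
Proof. by move=> [p [mp _]]; apply: (@xgetI _ 0 _ p). Qed.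

Lemma agree_opt_price (R : realType) (f g : R -> R) : agree f g ->
  opt_price f = opt_price g.
Proof.
move=> fg; rewrite /opt_price; congr xget; apply/seteqP.
by split => p /= [p1 h]; split => // x x1; have := h _ x1; rewrite !fg ?inE.
Qed.

Lemma agree_revenue (R : realType) (f g : R -> R) : agree f g ->
  agree (revenue f) (revenue g).
Proof. by move=> fg x x1; rewrite /revenue fg. Qed.

(** * Lengths and ends of the phases *)

Section phases.
Variables (R : realType) (n : nat).

Local Notation len := (cm_len R n).
Local Notation stop := (cm_end R n).

Lemma cm_end0 : stop 0 = 0%N.
Proof. by rewrite /cm_end big_geq. Qed.

Lemma cm_endS k : stop k.+1 = (stop k + len k.+1)%N.
Proof. by rewrite /cm_end big_nat_recr. Qed.

Hypothesis n1 : 1 <= ln n%:R :> R.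

(** Since [9 ^+ j * ln n] is at least 1, rounding it up at most doubles it. *)
Lemma cm_len_bounds j :
  9 ^+ j * ln n%:R <= ((len j)%:R : R) <= 2 * 9 ^+ j * ln n%:R.
Proof.
have h9 : 1 <= 9 ^+ j :> R by rewrite exprn_ege1// ler1n.
have h : 1 <= 9 ^+ j * ln n%:R :> R by rewrite -[leLHS]mulr1 ler_pM.
have c0 : (0 <= Num.ceil (9 ^+ j * ln n%:R : R))%R.
  by rewrite ceil_ge0 (lt_le_trans _ (le_trans ler01 h)).
rewrite /cm_len natr_absz ger0_norm//.
have := @ceil_ge _ (9 ^+ j * ln n%:R : R).
have := @ceilB1_lt _ (9 ^+ j * ln n%:R : R).
move=> h1 ->/=; lra.
Qed.

Lemma cm_len_gt0 j : (0 < len j)%N.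
Proof.
have /andP[h _] := cm_len_bounds j.
rewrite -(ltr_nat R); apply: lt_le_trans h.
by rewrite mulr_gt0 ?exprn_gt0// (lt_le_trans ltr01).
Qed.

Lemma cm_end_mono j k : (stop j <= stop k)%N = (j <= k)%N.
Proof.
apply: leq_mono => {j k}; apply: homo_ltn; first exact: ltn_trans.
by move=> k; rewrite cm_endS -[ltnLHS]addn0 ltn_add2l cm_len_gt0.
Qed.

Lemma leq_cm_end k : (k <= stop k)%N.
Proof.
elim: k => // k IH; rewrite cm_endS -addn1 leq_add//; exact: cm_len_gt0.
Qed.

Lemma cm_completedE k t : (stop k <= t < stop k.+1)%N ->
  cm_completed R n t = k.
Proof.
move=> /andP[kt tk]; rewrite /cm_completed.
have kt' := leq_trans (leq_cm_end k) kt.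
(* The range [1..t] is split at [k <= t]: every index up to [k] is counted and none beyond. *)
rewrite -(subnKC kt') iotaD count_cat.
rewrite (eq_in_count (a2 := predT)); last first.
  move=> j; rewrite mem_iota add1n ltnS => /andP[_ jk] /=.
  by rewrite subnKC// (leq_trans _ kt)// cm_end_mono.
rewrite count_predT size_iota (eq_in_count (a2 := pred0)) ?count_pred0 ?addn0//.
move=> j; rewrite mem_iota add1n => /andP[jk _] /=.
by rewrite subnKC//; apply/negbTE; rewrite -ltnNge (leq_trans tk)// cm_end_mono.
Qed.

Lemma cm_completedP t :
  exists2 k, cm_completed R n t = k & (stop k <= t < stop k.+1)%N.
Proof.
have ex : exists k, (t < stop k.+1)%N by exists t; exact: leq_cm_end.
case: (ex_minnP ex) => k tk hk.
have kt : (stop k <= t)%N.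
  case: k tk hk => [|k] tk hk; first by rewrite cm_end0.
  by rewrite leqNgt; apply/negP => /hk; rewrite ltnn.
by exists k; [apply: cm_completedE|]; rewrite kt tk.
Qed.

End phases.

Lemma itvI01 (R : realType) (x : R) : I01 x <-> 0 <= x <= 1.
Proof. by rewrite /I01 /= in_itv. Qed.

(** * Confidence windows and the prices they produce *)

Section cm_price.
Variables (R : realType) (Theta : set R) (dem est : R -> R -> R).
Variables (c2 csg cstar : R) (n : nat).

Local Notation popt theta := (opt_price (revenue (dem ^~ theta))).
Local Notation P := (cm_price Theta dem est c2 csg n).

Hypothesis cTheta : compact Theta.
Hypothesis popt01 : forall theta, Theta theta -> I01 (popt theta).
Hypothesis popt_lip : forall a b, Theta a -> Theta b ->
  `|popt a - popt b| <= cstar * `|a - b|.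
Hypothesis cstar0 : 0 <= cstar.

Let window (th w : R) : set R :=
  [set popt theta | theta in [set theta | Theta theta /\ `|theta - th| <= w]].

Let window_ub th w : has_ubound (window th w).
Proof. by exists 1 => _ [a [Ta _] <-]; have /itvI01/andP[] := popt01 Ta. Qed.

Lemma cm_cautious01 th w : I01 (cm_cautious Theta dem th w).
Proof.
rewrite /cm_cautious -/(window th w); apply/itvI01.
have [[x Sx]|/nonemptyPn ->] := pselect (window th w !=set0);
  last by rewrite sup0 lexx ler01.
apply/andP; split.
  have [a [Ta _] ax] := Sx; have /itvI01/andP[+ _] := popt01 Ta.
  by rewrite ax => /le_trans; apply; exact: ub_le_sup.
apply: ge_sup; first by exists x.
by move=> _ [a [Ta _] <-]; have /itvI01/andP[] := popt01 Ta.
Qed.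

(** The true parameter lies in the window, which gives the lower bound. Any other parameter of the
    window is within [2 w] of it, and the Lipschitz bound on optimal prices gives the upper one. *)
Lemma cm_cautious_bounds theta th w : Theta theta -> `|th - theta| <= w ->
  popt theta <= cm_cautious Theta dem th w <= popt theta + 2 * cstar * w.
Proof.
move=> T0 hw; rewrite /cm_cautious -/(window th w).
have S0 : window th w (popt theta) by exists theta => //; split; rewrite //= distrC.
rewrite ub_le_sup//=; apply: ge_sup; first by exists (popt theta).
move=> _ [a [Ta aw] <-].
have h : `|a - theta| <= 2 * w.
  rewrite -(subrK th a) -addrA (le_trans (ler_normD _ _))//.
  by rewrite mulr2n mulrDl mul1r lerD.
have := le_trans (ler_norm _) (popt_lip Ta T0).
have := ler_wpM2l cstar0 h.
rewrite lerBlDl => h1 h2.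
by rewrite (le_trans h2)// lerD2l (le_trans h1)// mulrCA mulrA.
Qed.

Lemma cm_price01 h k : I01 (P h k).
Proof.
elim: k => [|k IH]; first by apply/itvI01; rewrite /= ler01 lexx.
rewrite [P h k.+1]/=; set c := cm_cautious _ _ _ _.
have /itvI01/andP[a1 a2] : I01 c by exact: cm_cautious01.
by move/itvI01 : IH => /andP[b1 b2]; apply/itvI01; rewrite le_min ge_min a1 a2 b1.
Qed.

Lemma cm_mean_prefix (h h' : seq R) j : (0 < j)%N ->
  (forall i, (i < cm_end R n j)%N -> h`_i = h'`_i) ->
  cm_mean n h j = cm_mean n h' j.
Proof.
move=> j0 hh; congr (_ / _); rewrite big_nat_cond [RHS]big_nat_cond.
by apply: eq_bigr => i /andP[/andP[_ ij] _]; exact: hh.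
Qed.

(** The price after [k] phases uses only the demands of these phases, so it can be read off any
    longer history. *)
Lemma cm_price_prefix (h h' : seq R) k :
  (forall i, (i < cm_end R n k)%N -> h`_i = h'`_i) -> P h k = P h' k.
Proof.
elim: k => //= k IH hh; rewrite IH ?(cm_mean_prefix _ hh)// => i ik.
by apply: hh; rewrite cm_endS ltn_addr.
Qed.

Hypothesis mest : measurable_fun (I01 `*` setT) (fun a : R * R => est a.1 a.2).

Lemma measurable_cm_price d (T : measurableType d) (D : nat -> T -> R) t k :
  measurable_fun setT (fun w : past D t => P (mkseq (D ^~ w) t) k).
Proof.
elim: k => [|k IH]; first exact: measurable_cst.
apply: measurable_minr => //.
have mm : measurable_fun setT
    (fun w : past D t => cm_mean n (mkseq (D ^~ w) t) k.+1).
  apply: measurable_funM => //; apply: measurable_sum => i.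
  (* Entries beyond the history read as the default 0, so measurability holds even for phases not
     yet completed. *)
  have [it|ti] := ltnP i t.
    rewrite (_ : (fun w : T => _) = D i); first exact: measurable_past.
    by apply/funext => w; rewrite nth_mkseq.
  rewrite (_ : (fun w : T => _) = cst 0); first exact: measurable_cst.
  by apply/funext => w; rewrite nth_default// size_mkseq.
have mg : measurable_fun setT
    (fun th => cm_cautious Theta dem th (cm_width n c2 csg k.+1)).
  apply: (@measurable_window_sup _ _ (fun theta => popt theta) cstar) => //.
apply: (measurableT_comp mg).
apply: (@measurable_comp _ _ _ _ _ _ (I01 `*` setT)
  (fun a : R * R => est a.1 a.2) _
  (fun w : past D t =>
    (P (mkseq (D ^~ w) t) k, cm_mean n (mkseq (D ^~ w) t) k.+1))).
- by apply: measurableX => //; exact: measurable_itv.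
- by move=> _ [w _ <-]; split => //; exact: cm_price01.
- exact: mest.
- exact/measurable_fun_pairP.
Qed.

Lemma cm_price_bounds (h : seq R) m theta : Theta theta ->
  (forall j, (j < m)%N -> `|est (P h j) (cm_mean n h j.+1) - theta| <=
    cm_width n c2 csg j.+1) ->
  forall k, (k <= m)%N -> popt theta <= P h k /\
    ((0 < k)%N -> P h k <= popt theta + 2 * cstar * cm_width n c2 csg k).
Proof.
move=> T0 hj; elim => [|k IH] km.
  by split => //=; have /itvI01/andP[] := popt01 T0.
have [IH1 _] := IH (ltnW km).
have /andP[h1 h2] := cm_cautious_bounds T0 (hj _ km).
by rewrite /= le_min h1 IH1; split => // _; rewrite ge_min h2.
Qed.

End cm_price.

(** One demand value determines the demand function, which in turn determines its parameter. *)
Lemma inv_demandK (R : realType) (F : set (R -> R)) (Theta : set R)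
    (dem : R -> R -> R) p theta :
  parametrizes F Theta dem ->
  (forall p d d', I01 p -> F d -> F d' -> d p = d' p -> agree d d') ->
  I01 p -> Theta theta -> inv_demand Theta dem p (dem p theta) = theta.
Proof.
move=> [par _ inj] inj_p p1 T0; apply: xget_unique => // b [Tb e].
have [g Fg bg] := par _ Tb; have [g' Fg' tg] := par _ T0.
apply: inj => // x x1; rewrite bg// tg//.
by apply: (inj_p p) => //; rewrite -bg ?inE// -tg ?inE.
Qed.

(** * Geometric sums over the phases *)

Section phase_sums.
Variables (R : realType) (n : nat).
Hypothesis n1 : 1 <= ln n%:R :> R.

Lemma sum_completed (g : nat -> R) M :
  \sum_(0 <= t < cm_end R n M) g (cm_completed R n t) =
  \sum_(0 <= k < M) (cm_len R n k.+1)%:R * g k.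
Proof.
elim: M => [|M IH]; first by rewrite cm_end0 !big_geq.
rewrite big_nat_recr//= -IH (@big_cat_nat _ _ _ (cm_end R n M))//=; last first.
  by rewrite cm_end_mono.
congr (_ + _).
rewrite (eq_big_nat _ _ (F2 := fun=> g M)); last by move=> t /(cm_completedE n1) ->.
by rewrite sumr_const_nat cm_endS addKn mulr_natl.
Qed.

Lemma geometric_third_le N : \sum_(0 <= k < N) (3^-1) ^+ k <= 3 / 2 :> R.
Proof.
suff : \sum_(0 <= k < N) (3^-1) ^+ k = 3 / 2 * (1 - 3^-1 ^+ N) :> R.
  move=> ->; rewrite ler_piMr// lerBlDr lerDl exprn_ge0//.
elim: N => [|N IH]; first by rewrite big_geq// expr0 subrr mulr0.
by rewrite big_nat_recr//= IH exprS; field.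
Qed.

(** Phase [k + 1] has at most [18 * 9^k * ln n] rounds of loss [B / 27^k] each; the resulting series
    of ratio 1/3 sums to at most 3/2, and [18 * 3/2 = 27]. *)
Lemma sum_completed_le (B : R) : 0 <= B ->
  \sum_(0 <= t < n) B * (27^-1) ^+ cm_completed R n t <= 27 * B * ln n%:R.
Proof.
move=> B0; have L0 : 0 <= ln n%:R :> R by exact: le_trans n1.
have t0 k : 0 <= B * 27^-1 ^+ k :> R by rewrite mulr_ge0// exprn_ge0.
(* The phase in progress at the horizon is completed, by extending the sum to the end of phase [n],
   so that only full phases remain. *)
apply: (@le_trans _ _
  (\sum_(0 <= t < cm_end R n n) B * (27^-1) ^+ cm_completed R n t)).
  by rewrite [leRHS](@big_cat_nat _ _ _ n)//= ?leq_cm_end// lerDl sumr_ge0.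
rewrite (sum_completed (fun k => B * (27^-1) ^+ k)).
apply: (@le_trans _ _ (\sum_(0 <= k < n) 18 * B * ln n%:R * (3^-1) ^+ k)).
  apply: ler_sum_nat => k _; have /andP[_ h] := cm_len_bounds n1 k.+1.
  apply: (le_trans (ler_wpM2r (t0 k) h)).
  have -> : (3^-1 : R) = 9 * 27^-1 by field.
  by rewrite le_eqVlt; apply/orP; left; apply/eqP; rewrite exprMn exprS; ring.
rewrite -mulr_sumr.
apply: (le_trans (ler_wpM2l _ (geometric_third_le n))).
  by rewrite !mulr_ge0.
by rewrite le_eqVlt; apply/orP; left; apply/eqP; field.
Qed.

Lemma cm_width_le (c2 csg : R) k : 0 <= c2 -> 0 <= csg ->
  cm_width n c2 csg k <= 4 * c2 * csg * (3^-1) ^+ k.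
Proof.
move=> c20 csg0; rewrite /cm_width ler_wpM2l ?mulr_ge0//.
have L0 : 0 < ln n%:R :> R by exact: lt_le_trans n1.
have l0 : 0 < (cm_len R n k)%:R :> R by rewrite ltr0n cm_len_gt0.
rewrite -ler_sqr ?nnegrE ?sqrtr_ge0 ?exprn_ge0//.
rewrite sqr_sqrtr ?divr_ge0 ?(ltW L0) ?(ltW l0)// ler_pdivrMr// -exprM mulnC exprM.
have -> : (3^-1 : R) ^+ 2 = 9^-1 by field.
have /andP[h _] := cm_len_bounds n1 k.
apply: (@le_trans _ _ ((9^-1) ^+ k * (9 ^+ k * ln n%:R))).
  by rewrite mulrA -exprMn mulVf ?expr1n ?mul1r// pnatr_eq0.
by rewrite ler_wpM2l// exprn_ge0.
Qed.

(** A phase that ends by round [n] has [exp (j + 1) <= 9^(j+1) <= n], so at most [ln n] phases are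
    completed. *)
Lemma cm_end_le_horizon j : (cm_end R n j.+1 <= n)%N ->
  (j < Num.truncn (ln n%:R : R))%N.
Proof.
move=> jn; rewrite truncn_gt_nat.
have L0 : 0 < ln n%:R :> R by exact: lt_le_trans n1.
have n0 : 0 < n%:R :> R.
  by rewrite ltNge; apply/negP => /ln0 h; rewrite h ltxx in L0.
rewrite -ler_expR lnK ?posrE//.
(* From [exp (1/2) * (1 - 1/2) <= 1], in fact [exp 1 <= 4]. *)
have e4 : expR 1 <= 9 :> R.
  have h := expR_mul_subr_le1 (1 / 2 : R).
  have -> : expR 1 = expR (1 / 2) * expR (1 / 2) :> R by rewrite -expRD -splitr.
  have := expR_gt0 (1 / 2 : R); nra.
rewrite -[j.+1%:R]mulr1 expRM_natl.
have /andP[h _] := cm_len_bounds n1 j.+1.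
apply: (@le_trans _ _ (9 ^+ j.+1)); first by rewrite lerXn2r ?nnegrE ?expR_ge0.
apply: (@le_trans _ _ (9 ^+ j.+1 * ln n%:R)).
  by rewrite ler_peMr// exprn_ge0.
by rewrite (le_trans h)// ler_nat (leq_trans _ jn)// cm_endS leq_addl.
Qed.

End phase_sums.

(** * Regret of the policy *)

(** Some admissible constant lies below [c], and the integral decreases as the constant grows. *)
Lemma sg_norm_lt (R : realType) (mu : {measure set R -> \bar R}) (a c : R) :
  (sg_norm mu <= a%:E)%E -> a < c ->
  (\int[mu]_y (expR (y ^+ 2 / c ^+ 2))%:E <= 2%:E)%E.
Proof.
move=> h ac; have : (sg_norm mu < c%:E)%E by rewrite (le_lt_trans h)// lte_fin.
move=> /ereal_inf_lt[_ [b [b0 hb] <-]]; rewrite lte_fin => bc.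
apply: le_trans hb; apply: ge0_le_integral => //.
- by apply/measurable_EFinP; apply: measurableT_comp => //; exact: measurable_funM.
- by apply/measurable_EFinP; apply: measurableT_comp => //; exact: measurable_funM.
- move=> y _; rewrite lee_fin ler_expR ler_wpM2l ?sqr_ge0//.
  rewrite lef_pV2 ?posrE ?exprn_gt0//; last exact: lt_trans bc.
  by rewrite lerXn2r ?nnegrE// ltW// (lt_trans b0).
Qed.

Lemma C2_on_measurable (R : realType) (Theta : set R) (f : R -> R -> R) theta :
  C2_on Theta f -> Theta theta -> measurable_fun (I01 : set R) (f ^~ theta).
Proof.
move=> [g [[cg _] gf]] T0.
apply: (@eq_measurable_fun _ _ _ _ _ (fun x => g (x, theta) : R)).
  by move=> x /set_mem x1; rewrite gf.
apply: measurable_funTS; apply: continuous_measurable_fun => x.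
apply: (@continuous_comp _ _ _ (fun x : R => (x, theta)) g); last exact: cg.
exact: (@cvg_pair _ _ _ (nbhs x) (nbhs x) (nbhs theta) _ _ _ id (cst theta)
  cvg_id (@cvg_cst _ theta _ _ _)).
Qed.

Section cm_regret.
Variables (R : realType) (F : set (R -> R)) (Theta : set R).
Variables (dem est : R -> R -> R) (cstar c2 csg : R).
Hypothesis hF : regular_family F.
Hypothesis h0 : zero_crossing F Theta dem cstar c2.
Hypothesis csg0 : 0 < csg.
Hypothesis hest : inverse_extension Theta dem c2 est.

Local Notation popt theta := (opt_price (revenue (dem ^~ theta))).

Lemma popt_maximizer theta : Theta theta ->
  maximizer (revenue (dem ^~ theta)) (popt theta).
Proof.
move=> T0; have [_ [[par _ _] _ _ _ _]] := h0.
have [g Fg tg] := par _ T0.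
have [_ [_ ex _]] := hF Fg.
have rtg := agree_revenue tg.
rewrite (agree_opt_price rtg).
have [p1 pm] := opt_priceP ex; split => // x x1.
by rewrite !rtg ?inE//; exact: pm.
Qed.

Lemma popt_lipschitz a b : Theta a -> Theta b ->
  `|popt a - popt b| <= cstar * `|a - b|.
Proof.
have [_ [_ _ _ [_ lip] _]] := h0.
by move=> Ta Tb; exact: (lip (a, b) (conj Ta Tb)).
Qed.

(** At the exact demand [dem p theta] the estimate is [theta]. The extension is Lipschitz on all of
    R, so [y] may lie outside the range of demands. *)
Lemma est_error p theta y : I01 p -> Theta theta ->
  `|est p y - theta| <= c2 * `|y - dem p theta|.
Proof.
move=> p1 T0; have [inj [par _ _ _ _]] := h0.
have [_ /(_ p p1)[inv lip]] := hest.
rewrite -[X in _ - X](inv_demandK par inj p1 T0) -inv; last by exists theta.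
exact: (lip (y, dem p theta) (conj I I)).
Qed.

Variable n : nat.
Hypothesis n1 : 1 <= ln n%:R :> R.

Local Notation pi := (cm_policy Theta dem est c2 csg n).
Local Notation stop := (cm_end R n).
Local Notation len := (cm_len R n).

Variables (d : R -> R) (theta : R) (S : demand_process R).
Hypothesis Fd : F d.
Hypothesis T0 : Theta theta.
Hypothesis agd : agree (dem ^~ theta) d.
Hypothesis hS : runs pi n d csg S.

Local Notation P := (dp_prob S).
Local Notation D := (dp_demand S).

Let popt01 a : Theta a -> I01 (popt a).
Proof. by move=> /popt_maximizer[]. Qed.

Let mest : measurable_fun (I01 `*` setT) (fun a : R * R => est a.1 a.2).
Proof. by case: hest. Qed.

Let cTheta : compact Theta. Proof. by have [_ []] := h0. Qed.

Let mdem : measurable_fun (I01 : set R) d.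
Proof.
have [_ [_ _ C2 _ _]] := h0.
by apply: eq_measurable_fun (C2_on_measurable C2 T0) => x x1; rewrite agd.
Qed.

Lemma priceE t (w : dp_space S) :
  price pi t w =
  cm_price Theta dem est c2 csg n (mkseq (D ^~ w) t) (cm_completed R n t).
Proof. by rewrite /price /cm_policy size_mkseq. Qed.

Lemma price01 t (w : dp_space S) : I01 (price pi t w).
Proof. by rewrite priceE; exact: cm_price01. Qed.

Lemma measurable_price t :
  measurable_fun setT (price (S := S) pi t : past D t -> R).
Proof.
rewrite (_ : price (S := S) pi t = fun w =>
  cm_price Theta dem est c2 csg n (mkseq (D ^~ w) t) (cm_completed R n t)).
  by apply: (@measurable_cm_price _ _ _ _ _ _ cstar) => //; exact: popt_lipschitz.
by apply/funext => w; exact: priceE.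
Qed.

(** All rounds of a phase share one price, expressed here through the full history so that it no
    longer depends on the round. *)
Lemma price_phase t k (w : dp_space S) :
  (t <= n)%N -> (stop k <= t < stop k.+1)%N ->
  price pi t w = cm_price Theta dem est c2 csg n (mkseq (D ^~ w) n) k.
Proof.
move=> tn kt; rewrite priceE (cm_completedE n1 kt).
have /andP[kt1 _] := kt.
apply: cm_price_prefix => i ik.
have it := leq_trans ik kt1.
by rewrite !nth_mkseq// (leq_trans it).
Qed.

Local Notation Pn w k := (cm_price Theta dem est c2 csg n (mkseq (D ^~ w) n) k).

(** Allowed deviation of the empirical mean; [c2] times it is [cm_width]. *)
Let err j := 4 * csg * Num.sqrt (ln n%:R / (len j)%:R).

Lemma noise_phase j (w : dp_space S) : (stop j.+1 <= n)%N ->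
  noise D (price (S := S) pi) d (stop j) (stop j.+1) w =
  (len j.+1)%:R * (cm_mean n (mkseq (D ^~ w) n) j.+1 - d (Pn w j)).
Proof.
move=> jn; rewrite /noise /cm_mean /=.
have l0 : (len j.+1)%:R != 0 :> R by rewrite pnatr_eq0 -lt0n cm_len_gt0.
rewrite mulrBr mulrCA divff// mulr1.
have -> : (len j.+1)%:R * d (Pn w j) =
    \sum_(stop j <= t < stop j.+1) d (Pn w j).
  by rewrite sumr_const_nat cm_endS addKn mulr_natl.
rewrite -sumrB; apply: eq_big_nat => t tj.
have /andP[_ tj2] := tj; have tn := leq_trans tj2 jn.
by rewrite nth_mkseq// (price_phase _ (ltnW tn) tj).
Qed.

(** Empty for phases not completed by the horizon, since the law of the demands is prescribed only
    before round [n]. *)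
Let bad j : set (dp_space S) :=
  if (stop j.+1 <= n)%N then
    [set w | (len j.+1)%:R * err j.+1 <=
      `|noise D (price (S := S) pi) d (stop j) (stop j.+1) w|]
  else set0.

Let mD t : (t < n)%N -> measurable_fun setT (D t).
Proof. by move=> tn; have [+ _] := hS; exact. Qed.

Let L0 : 0 < ln n%:R :> R. Proof. exact: lt_le_trans n1. Qed.

Let n0 : 0 < n%:R :> R.
Proof. by rewrite ltNge; apply/negP => /ln0 h; have := L0; rewrite h ltxx. Qed.

(** With the optimal [l], the exponent of [noise_tail] is [(50/49 - 100/49) ln n], which is at most
    [- ln n]. *)
Lemma bad_prob j : (P (bad j) <= (2 / n%:R)%:E)%E.
Proof.
rewrite /bad; case: ifPn => [jn|_]; last first.
  by rewrite measure0 lee_fin divr_ge0// ltW.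
have [_ [nu [nu1 law]]] := hS.
(* [sg_norm] is an infimum that need not be attained, whence a constant larger
   than 1; its square must not exceed 2 for the tail to be at most [2/n]. *)
pose c := 7 / 5 * csg.
have c0 : 0 < c by rewrite mulr_gt0.
have l0 : 0 < (len j.+1)%:R :> R by rewrite ltr0n cm_len_gt0.
have e0 : 0 < err j.+1 by rewrite mulr_gt0 ?mulr_gt0// sqrtr_gt0 divr_gt0.
have esq : err j.+1 ^+ 2 = 16 * csg ^+ 2 * (ln n%:R / (len j.+1)%:R).
  rewrite /err !exprMn sqr_sqrtr; last by rewrite divr_ge0 ?ltW.
  by congr (_ * _ * _); ring.
(* the minimiser of the exponent in [noise_tail] *)
pose l := err j.+1 / (4 * c ^+ 2).
have lpos : 0 < l by rewrite divr_gt0// mulr_gt0// exprn_gt0.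
have lc : 2 * l ^+ 2 * c ^+ 2 = 50 / 49 * (ln n%:R / (len j.+1)%:R).
  have -> : 2 * l ^+ 2 * c ^+ 2 = err j.+1 ^+ 2 / (8 * c ^+ 2).
    by rewrite /l; field; rewrite gt_eqF.
  by rewrite esq /c; field; rewrite !gt_eqF.
(* This makes [2 l^2 c^2] at most 1, as the moment bound requires. *)
have len9 : ln n%:R / (len j.+1)%:R <= 9^-1 :> R.
  have /andP[h _] := cm_len_bounds n1 j.+1.
  rewrite ler_pdivrMr// ler_pdivlMl ?ltr0n//.
  apply: le_trans h; rewrite ler_wpM2r ?(ltW L0)// exprS ler_peMr ?ler0n//.
  by rewrite exprn_ege1// ler1n.
have stopj : (stop j <= stop j.+1)%N by rewrite cm_end_mono.
have tail := @noise_tail _ _ R P n D (price (S := S) pi) nu d c mD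
  (fun t _ => @measurable_price t) (fun t w _ => @price01 t w) _ mdem c0 _ _ l
  ((len j.+1)%:R * err j.+1) _ _ stopj jn lpos.
apply: le_trans; first apply: tail => //.
- by move=> p p1; have [] := nu1 p p1.
- move=> p p1; apply: (@sg_norm_lt _ _ csg); last first.
    by rewrite /c ltr_pMl ?csg0//; lra.
  by have [] := nu1 p p1.
- by rewrite lc; lra.
rewrite lee_fin ler_wpM2l// lc cm_endS addKn.
have -> : l * ((len j.+1)%:R * err j.+1) = 100 / 49 * ln n%:R.
  have -> : l * ((len j.+1)%:R * err j.+1) =
      (len j.+1)%:R * err j.+1 ^+ 2 / (4 * c ^+ 2).
    by rewrite /l; field; rewrite gt_eqF.
  by rewrite esq /c; field; rewrite !gt_eqF.
have -> : (len j.+1)%:R * (50 / 49 * (ln n%:R / (len j.+1)%:R)) =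
    50 / 49 * ln n%:R :> R.
  by field; rewrite gt_eqF.
rewrite -[n%:R in leRHS](lnK (R := R)) ?posrE// -expRN ler_expR.
by have := L0; lra.
Qed.

Let measurable_bad j : measurable (bad j).
Proof.
rewrite /bad; case: ifPn => // jn; rewrite -[X in measurable X]setTI.
apply: measurable_fun_le => //; apply: measurableT_comp => //.
have stopj : (stop j <= stop j.+1)%N by rewrite cm_end_mono.
apply: (@measurable_past_fun _ _ _ D (stop j.+1)).
  by move=> t tj; apply: mD; exact: leq_trans tj jn.
exact: (measurable_noise (fun t _ => @measurable_price t)
  (fun t w _ => @price01 t w) mdem stopj jn).
Qed.

Let m := Num.truncn (ln n%:R : R).

Let anybad : set (dp_space S) := \big[setU/set0]_(j < m) bad j.

Let measurable_anybad : measurable anybad.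
Proof. by apply: bigsetU_measurable => j _; exact: measurable_bad. Qed.

Lemma anybad_prob : (P anybad <= (2 * ln n%:R / n%:R)%:E)%E.
Proof.
rewrite /anybad.
apply: (le_trans (@Boole_inequality _ _ _ P bad m (fun j _ => measurable_bad j))).
apply: (@le_trans _ _ (\sum_(j < m) (2 / n%:R)%:E)%E).
  by apply: lee_sum => j _; exact: bad_prob.
rewrite sumEFin lee_fin sumr_const card_ord -[leLHS]mulr_natl mulrA.
rewrite ler_wpM2r ?invr_ge0 ?(ltW n0)// mulrC ler_wpM2l//.
by rewrite truncn_le ?(ltW L0).
Qed.

(** Off the bad events the mean of each completed phase is off by less than [err], so by [est_error]
    the estimate is within [cm_width] of [theta]. *)
Lemma good_price k w : ~ anybad w -> (stop k <= n)%N ->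
  popt theta <= Pn w k /\
  ((0 < k)%N -> Pn w k <= popt theta + 2 * cstar * cm_width n c2 csg k).
Proof.
move=> gw kn.
have cstar0 : 0 <= cstar by have [_ [_ _ _ [/ltW]]] := h0.
have c20 : 0 <= c2 by have [_ [_ _ _ _ [/ltW]]] := h0.
apply: (@cm_price_bounds _ Theta dem est c2 csg cstar n popt01 popt_lipschitz
  cstar0 _ k) => // j jk.
have jn : (stop j.+1 <= n)%N by apply: leq_trans kn; rewrite cm_end_mono.
have jm : (j < m)%N by exact: cm_end_le_horizon.
have : ~ bad j w.
  by move=> bw; apply: gw; rewrite /anybad (bigD1 (Ordinal jm))//=; left.
rewrite /bad jn /= noise_phase// => /negP; rewrite -ltNge.
have l0 : 0 < (len j.+1)%:R :> R by rewrite ltr0n cm_len_gt0.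
rewrite normrM gtr0_norm// ltr_pM2l// => hw.
have p1 : I01 (Pn w j) by exact: cm_price01.
apply: (le_trans (est_error _ p1 T0)).
rewrite agd ?inE// /cm_width -[4 * c2]mulrC -!mulrA ler_wpM2l// mulrA.
exact: ltW.
Qed.

Local Notation pstar := (popt theta).

Variable c3 : R.
Hypothesis c30 : 0 <= c3.
Hypothesis loss_le : forall x, I01 x -> pstar <= x ->
  revenue d pstar - revenue d x <= c3 * (x - pstar) ^+ 3.

Let r01 x : I01 x -> 0 <= revenue d x <= 1.
Proof.
move=> x1; have [/(_ x x1)/itvI01/andP[d0 d1] _] := hF Fd.
by move/itvI01 : x1 => /andP[x0 x1]; rewrite mulr_ge0//= mulr_ile1.
Qed.

(** The 1 covers the first phase. The cube comes from the overshoot [2 * cstar * cm_width], with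
    [cm_width] at most [4 * c2 * csg / 3^k]. *)
Definition loss_const : R := 1 + c3 * (8 * cstar * c2 * csg) ^+ 3.

Let cstar0 : 0 <= cstar. Proof. by have [_ [_ _ _ [/ltW]]] := h0. Qed.
Let c20 : 0 <= c2. Proof. by have [_ [_ _ _ _ [/ltW]]] := h0. Qed.

Let A0 : 0 <= 8 * cstar * c2 * csg.
Proof. by rewrite !mulr_ge0// ltW. Qed.

Let B0 : 0 <= loss_const.
Proof. by rewrite addr_ge0// mulr_ge0// exprn_ge0. Qed.

Lemma round_loss t w : (t < n)%N -> ~ anybad w ->
  revenue d pstar - revenue d (price pi t w) <=
    loss_const * (27^-1) ^+ cm_completed R n t.
Proof.
move=> tn gw; have [k -> kt] := cm_completedP n1 t.
rewrite (price_phase w (ltnW tn) kt).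
have p1 : I01 (Pn w k) by exact: cm_price01.
have /andP[kt1 _] := kt.
have [lo hi] := good_price gw (leq_trans kt1 (ltnW tn)).
have B1 : 1 <= loss_const by rewrite lerDl mulr_ge0// exprn_ge0.
(* In the first phase nothing has been learnt and the loss is bounded by 1, the range of the
   revenue. *)
case: k kt p1 kt1 lo hi => [|k] kt p1 kt1 lo hi.
  rewrite expr0 mulr1 (le_trans _ B1)//.
  have /andP[_ a1] := r01 (popt01 T0); have /andP[a2 _] := r01 p1.
  by rewrite lerBlDr (le_trans a1)// lerDl.
apply: (le_trans (loss_le p1 lo)).
rewrite /loss_const mulrDl mul1r (@le_trans _ _
    (c3 * (8 * cstar * c2 * csg) ^+ 3 * 27^-1 ^+ k.+1))//; last first.
  by rewrite lerDr exprn_ge0.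
have -> : (27^-1 : R) = 3^-1 ^+ 3 by field.
rewrite exprAC -mulrA -exprMn ler_wpM2l// lerXn2r ?nnegrE ?subr_ge0//.
  by rewrite mulr_ge0// exprn_ge0.
rewrite lerBlDl (le_trans (hi _))// lerD2l.
have := ler_wpM2l (mulr_ge0 (ler0n R 2) cstar0) (cm_width_le n1 k.+1 c20 (ltW csg0)).
by move=> /le_trans; apply; rewrite le_eqVlt; apply/orP; left; apply/eqP; ring.
Qed.

Lemma sup_revenue : sup (revenue d @` I01) = revenue d pstar.
Proof.
have [p1 pm] := popt_maximizer T0.
have rm x : I01 x -> revenue d x <= revenue d pstar.
  by move=> x1; have := pm x x1; rewrite !(agree_revenue agd) ?inE.
apply/eqP; rewrite eq_le; apply/andP; split.
  apply: ge_sup; first by exists (revenue d pstar); exists pstar.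
  by move=> _ [x x1 <-]; exact: rm.
apply: ub_le_sup; last by exists pstar.
by exists (revenue d pstar) => _ [x x1 <-]; exact: rm.
Qed.

(** Total revenue is at least [K] on the good event and nonnegative elsewhere, so its mean is at
    least [K * (1 - P anybad)]. As [K <= n], the bad event costs at most [2 ln n]. *)
Lemma cm_regret_le :
  (regret pi n d S <= ((27 * loss_const + 2) * ln n%:R)%:E)%E.
Proof.
rewrite /regret sup_revenue unlock.
pose f (w : dp_space S) := \sum_(t < n) revenue d (price pi t w).
change (((n%:R * revenue d pstar)%:E - \int[P]_w (f w)%:E)%E <=
  ((27 * loss_const + 2) * ln n%:R)%:E)%E.
have f0 w : 0 <= f w.
  by apply: sumr_ge0 => t _; have /andP[] := r01 (price01 t w).
have mf : measurable_fun setT f.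
  apply: measurable_sum => t.
  apply: (@measurable_past_fun _ _ _ D t) => [i it|].
    by apply: mD; exact: ltn_trans it (ltn_ord t).
  apply: measurable_funM; first exact: measurable_price.
  apply: (measurable_comp (F := I01)) => //.
  - exact: measurable_itv.
  - by move=> _ [w _ <-]; exact: price01.
  - exact: measurable_price.
have E0 : (0 <= \int[P]_w (f w)%:E)%E.
  by apply: integral_ge0 => w _; rewrite lee_fin.
have /andP[r0 r1] := r01 (popt01 T0).
pose K := n%:R * revenue d pstar - 27 * loss_const * ln n%:R.
(* If [K < 0], the optimal total revenue itself is below the claimed bound. *)
have [K0|K0] := ltP K 0.
  apply: (@le_trans _ _ (n%:R * revenue d pstar)%:E).
    by rewrite -[leRHS]sube0 leeB.
  rewrite lee_fin mulrDl -lerBlDl (le_trans (ltW K0))// mulr_ge0// ltW//.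
have fK w : ~ anybad w -> K <= f w.
  move=> gw; rewrite lerBlDr -lerBlDl.
  apply: le_trans (sum_completed_le n1 B0).
  rewrite /f -(big_mkord xpredT (fun t => revenue d (price pi t w))).
  have -> : n%:R * revenue d pstar = \sum_(0 <= t < n) revenue d pstar.
    by rewrite sumr_const_nat subn0 mulr_natl.
  by rewrite -sumrB; apply: ler_sum_nat => t /andP[_ tn]; exact: round_loss.
have low : (K%:E * P (~` anybad) <= \int[P]_w (f w)%:E)%E.
  have mC : measurable (~` anybad) by exact: measurableC.
  have mI : measurable_fun setT (fun w => (\1_(~` anybad) w)%:E : \bar R).
    by apply/measurable_EFinP; exact: measurable_indic.
  have -> : P (~` anybad) = (\int[P]_w (\1_(~` anybad) w)%:E)%E.
    by rewrite integral_indic// setIT.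
  rewrite -ge0_integralZl_EFin//.
  apply: ge0_le_integral => //.
  - by move=> w _; rewrite -EFinM lee_fin mulr_ge0.
  - exact: measurable_funeM.
  - exact/measurable_EFinP.
  - move=> w _; rewrite -EFinM lee_fin indicE.
    have [/set_mem gw|_] := boolP (w \in ~` anybad); last by rewrite mulr0.
    by rewrite mulr1 fK.
have low2 : ((K - 2 * ln n%:R)%:E <= \int[P]_w (f w)%:E)%E.
  apply: le_trans low.
  rewrite probability_setC//.
  apply: (@le_trans _ _ (K%:E * (1 - (2 * ln n%:R / n%:R)%:E))%E); last first.
    by rewrite lee_wpmul2l ?lee_fin// leeB// anybad_prob.
  rewrite -EFinB -EFinM lee_fin mulrBr mulr1 lerD2l lerN2 mulrA ler_pdivrMr//.
  rewrite mulrC ler_wpM2l ?mulr_ge0 ?(ltW L0)//.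
  rewrite /K lerBlDr (@le_trans _ _ n%:R)//.
    by rewrite ler_piMr.
  by rewrite lerDl !mulr_ge0// ltW.
apply: (le_trans (leeB (lexx _) low2)).
by rewrite -EFinB lee_fin /K le_eqVlt; apply/orP; left; apply/eqP; ring.
Qed.

End cm_regret.

Theorem theorem4 (R : realType) (s : nat) (F : set (R -> R))
    (Theta : set R) (dem : R -> R -> R) (cstar c2 csg : R)
    (est : R -> R -> R)
    (hs : (2 < s)%N)
    (hF : regular_family F)
    (h0 : zero_crossing F Theta dem cstar c2)
    (hsens : sensitive_family s F)
    (hcsg : 0 < csg)
    (hest : inverse_extension Theta dem c2 est) :
  exists (C : R) (N : nat), forall n : nat, (N <= n)%N ->
    forall S : (R -> R) -> demand_process R,
      (forall d, F d ->
        runs (cm_policy Theta dem est c2 csg n) n d csg (S d)) ->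
      (family_regret (cm_policy Theta dem est c2 csg n) n F S
        <= (C * ln n%:R)%:E)%E.
Proof.
have [sens exT _] := hsens; have [Th2 [rv [[_ par' _] _ _ _ bd]]] := exT.
have [c3 hc3] := bd 3 hs.
(* Over an empty parameter set [c3] could be negative. *)
pose c := Num.max c3 0.
have c0 : 0 <= c by rewrite le_max lexx orbT.
(* The constant does not depend on the demand function, so the bound is uniform over [F]. The
   threshold ensures [n >= e], i.e. [ln n >= 1]. *)
exists (27 * loss_const cstar c2 csg c + 2), (Num.truncn (expR 1 : R)).+1.
move=> n Nn S hS.
have n1 : 1 <= ln n%:R :> R.
  have h : expR 1 <= n%:R :> R.
    by rewrite ltW// (lt_le_trans (truncnS_gt _))// ler_nat.
  by rewrite -[leLHS](expRK 1) ler_ln ?posrE ?expR_gt0// (lt_le_trans (expR_gt0 1)).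
apply: ge_ereal_sup => _ [d Fd <-].
have [_ [[_ par _] _ _ _ _]] := h0.
have [theta T0 agd] := par _ Fd.
have Rd : [set revenue d' | d' in F] (revenue d) by exists d.
have [[Ck _] r0 _] := sens _ Rd.
(* The derivative bounds belong to the parametrization of the revenues, so [theta'] need not be
   [theta]; the two meet in [revenue d]. *)
have [theta' T0' agr] := par' _ Rd.
have popt : opt_price (revenue (dem ^~ theta)) = opt_price (revenue d).
  exact/agree_opt_price/agree_revenue.
apply: (cm_regret_le hF h0 hcsg hest n1 Fd T0 agd (hS _ Fd) c0) => x x1.
have [p1 _] := popt_maximizer hF h0 T0.
move: p1; rewrite popt => p1 px.
(* Since [s >= 3], the first two derivatives of the revenue vanish at the optimal price and the
   third is bounded by [c]. *)
rewrite (le_trans (ler_norm _))// distrC; apply: taylor3 => //.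
- by move=> j y j3; apply: Ck; rewrite ltnS ltnW// (leq_trans j3).
- by apply: r0; rewrite /= (ltn_trans _ hs).
- exact: r0.
- move=> y y1; rewrite -(agree_derive01n 3 agr) ?inE//.
  by rewrite (le_trans (hc3 y theta' y1 T0'))// le_max lexx.
Qed.
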